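(* Let $\mathcal{H}'\subseteq\mathcal{H}^1$, and let the cost $c(x,y)=h(x-y)$ on $\mathbb{R}\times\mathbb{R}$ be induced by a function $h\in\mathcal{H}'$. Suppose that the marginal distributions are related by a location-scale family whose generator $G$ is a cumulative distribution function that is strictly increasing and differentiable with Lebesgue density $g$; that is, the observed marginal pairs are $(G_{a,b},G)$ with $a\in\mathbb{R}$, $b>0$, $b\neq1$. Then the cost $c$ is identifiable from its optimal transport costs in the class of cost functions induced by $\mathcal{H}'\cap L^1(G)$ if and only if the $g$-transform is injective on $\mathcal{H}'\cap L^1(G)$.
   Context: $\mathcal{H}^1$ is the set of convex functions $h:\mathbb{R}\to[0,\infty)$ with $h(0)=0$. $L^1(G)$ is the set of functions on $\mathbb{R}$ integrable with respect to the probability measure with c.d.f. $G$. $G_{a,b}(x)=G((x-a)/b)$ for $(a,b)\in\mathbb{R}\times(0,\infty)$, and $G=G_{0,1}$. For c.d.f.s $F,\tilde F$ on $\mathbb{R}$, the optimal transport cost between the corresponding probability measures for the cost $h(x-y)$, $h\in\mathcal{H}^1$, is $\alpha_h(F,\tilde F)=\int_0^1 h(F^{-1}[u]-\tilde F^{-1}[u])\,du$, where $F^{-1},\tilde F^{-1}$ are the quantile functions; hence $\alpha_h(G_{a,b},G)=\int_0^1 h(a+(b-1)G^{-1}[u])\,du$. It is assumed throughout that these costs are finite for all functions $h$ and marginal pairs considered. Identifiability in the class induced by $\mathcal{H}'\cap L^1(G)$ means: whenever $h_1,h_2\in\mathcal{H}'\cap L^1(G)$ satisfy $\alpha_{h_1}(G_{a,b},G)=\alpha_{h_2}(G_{a,b},G)$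 for all $a\in\mathbb{R}$ and all $b>0$ with $b\ne1$, then $h_1=h_2$. The $g$-transform of $h$ is the function $$\mathcal{I}_g[h](a,\beta)=\int_{-\infty}^\infty g\!\left(\frac{x-a}{\beta}\right)h(x)\,dx,$$ with $(a,\beta)$ ranging over the reparametrized set obtained from $\beta=b-1$, i.e. $a\in\mathbb{R}$, $\beta\in(-1,\infty)\setminus\{0\}$. Injectivity on a set of functions means that $\mathcal{I}_g[h_1]=\mathcal{I}_g[h_2]$ for $h_1,h_2$ in that set implies $h_1=h_2$. *)

(* Defs.v *)
From mathcomp Require Import all_boot all_order all_algebra.
From mathcomp Require Import all_classical all_reals all_analysis.

Set Implicit Arguments.
Unset Strict Implicit.
Unset Printing Implicit Defensive.

Import Order.TTheory GRing.Theory Num.Theory.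
Import numFieldNormedType.Exports.

Local Open Scope classical_set_scope.
Local Open Scope ring_scope.

Definition H1 (R : realType) : set (R -> R) :=
  [set h : R -> R | [/\ @convex_function R R^o setT h,
                        forall x, 0 <= h x & h 0 = 0]].

(* Genuine functions, not classes modulo a.e. equality. *)
Definition L1 (R : realType) (G : cumulativeBounded (0 : R) (1 : R)) :
    set (R -> R) :=
  [set h : R -> R |
    (lebesgue_stieltjes_measure G).-integrable [set: R] (EFin \o h)].

Definition is_density (R : realType) (G : cumulativeBounded (0 : R) (1 : R))
    (g : R -> R) : Prop :=
  [/\ measurable_fun [set: R] g,
      forall x, 0 <= g x
    & forall A : set R, measurable A ->
        lebesgue_stieltjes_measure G A =
        (\int[lebesgue_measure]_(x in A) (g x)%:E)%E].

Definition loc_scale (R : realType) (G : R -> R) (a b : R) : R -> R :=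
  fun x => G ((x - a) / b).

(* Meaningful for 0 < u < 1: [inf] takes the junk value 0 on sets that are
   empty or not bounded below. *)
Definition quantile (R : realType) (F : R -> R) (u : R) : R :=
  inf [set x | u <= F x].

(* The end points 0 and 1, where quantiles may be infinite, are left out of the
   integration domain. *)
Definition ot_cost (R : realType) (h F F' : R -> R) : \bar R :=
  (\int[lebesgue_measure]_(u in `]0%R, 1%R[)
     (h (quantile F u - quantile F' u)%R)%:E)%E.

Definition identifiable (R : realType) (G : R -> R) (K : set (R -> R)) : Prop :=
  forall h1 h2 : R -> R, K h1 -> K h2 ->
    (forall a b : R, 0 < b -> b != 1 ->
       ot_cost h1 (loc_scale G a b) G = ot_cost h2 (loc_scale G a b) G) ->
    h1 = h2.

Definition g_transform (R : realType) (g h : R -> R) (a beta : R) : \bar R :=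
  (\int[lebesgue_measure]_x (g ((x - a) / beta) * h x)%:E)%E.

(* The transform of [h] is a function on R x ((-1, +oo) \ {0}) only. *)
Definition g_transform_injective (R : realType) (g : R -> R)
    (K : set (R -> R)) : Prop :=
  forall h1 h2 : R -> R, K h1 -> K h2 ->
    (forall a beta : R, -1 < beta -> beta != 0 ->
       g_transform g h1 a beta = g_transform g h2 a beta) ->
    h1 = h2.

(* Main.v *)
(** With beta = b - 1, quantile G_{a,b} = a + b * quantile G, so the transport
    cost is the integral of h (a + beta * quantile G u) over 0 < u < 1.  The
    quantile function pushes the uniform law forward to the law with density g,
    hence the cost is the integral of h (a + beta * x) g x dx, and substituting
    y = a + beta * x gives I_g[h](a, beta) = |beta| * alpha_h(G_{a,b}, G).  So
    equality of transforms and equality of costs are the same condition on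
    (h1, h2). *)

Require Import Defs.
From mathcomp Require Import all_boot all_order all_algebra.
From mathcomp Require Import all_classical all_reals all_analysis.
From mathcomp Require Import measurable_realfun ring lra.

Import Order.TTheory GRing.Theory Num.Theory.
Import numFieldNormedType.Exports.

Local Open Scope classical_set_scope.
Local Open Scope ring_scope.

(** The complement of [D] is null for the restricted measure, and the two measures agree on subsets
    of [D]. *)
Lemma ge0_integral_mrestr d (T : measurableType d) (R : realType)
    (mu : {measure set T -> \bar R}) (D : set T) (mD : measurable D)
    (f : T -> \bar R) :
    measurable_fun [set: T] f -> (forall x, 0 <= f x)%E ->
  (\int[mrestr mu mD]_x f x = \int[mu]_(x in D) f x)%E.
Proof.
move=> mf f0.
rewrite [LHS](@ge0_negligible_integral _ _ _ _ _ (~` D))//=.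
- rewrite setTD setCK; apply: eq_measure_integral => A mA AD /=.
  by rewrite /mrestr setIidl.
- exact: measurableC.
- by rewrite /mrestr setICl measure0.
Qed.

Lemma measurable_affine {R : realType} (a b : R) :
  measurable_fun [set: R] (fun x : R => a + b * x).
Proof. by apply: measurable_funD => //; exact: measurable_funM. Qed.

(** By uniqueness of Lebesgue measure: the right-hand side is a scaled pushforward measure, so it
    suffices to check that it gives []c, d]] its length. *)
Lemma lebesgue_measure_affine {R : realType} (a b : R) (A : set R) :
    b != 0 -> measurable A ->
  lebesgue_measure A =
  (`|b|%:E * lebesgue_measure ((fun x => (a + b * x)%R) @^-1` A))%E.
Proof.
move=> b0 mA.
pose phi : measurableTypeR R -> measurableTypeR R := fun x => a + b * x.
apply: (@lebesgue_measure_unique _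
  (mscale (NngNum (normr_ge0 b)) (pushforward lebesgue_measure phi)) _ _ mA).
  exact: measurable_affine.
move=> mphi _ [[c d]] _ <-.
rewrite -[RHS]/(`|b|%:E *
  lebesgue_measure ((fun x : R => (a + b * x)%R) @^-1` `]c, d]%classic))%E.
have [bn|bp|bE] := ltgtP b 0; last by rewrite bE eqxx in b0.
(* A negative slope reverses the interval, so the closed end moves to the left. *)
- rewrite (_ : _ @^-1` _ = `[(d - a) / b, (c - a) / b[%classic); last first.
    apply/seteqP; split => x /=; rewrite !in_itv/= ler_ndivrMr// ltr_ndivlMr//;
      move=> /andP[? ?]; apply/andP; split; lra.
  rewrite !lebesgue_measure_itv/= !lte_fin ltr_nM2r ?invr_lt0// ltrD2r.
  case: ifPn => _; last by rewrite mule0.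
  rewrite -!EFinB -EFinM; congr EFin; rewrite ltr0_norm//; field => //.
- rewrite (_ : _ @^-1` _ = `](c - a) / b, (d - a) / b]%classic); last first.
    apply/seteqP; split => x /=; rewrite !in_itv/= ler_pdivlMr// ltr_pdivrMr//;
      move=> /andP[? ?]; apply/andP; split; lra.
  rewrite !lebesgue_measure_itv/= !lte_fin ltr_pM2r ?invr_gt0// ltrD2r.
  case: ifPn => _; last by rewrite mule0.
  rewrite -!EFinB -EFinM; congr EFin; rewrite gtr0_norm//; field => //.
Qed.

Lemma ge0_integral_affine {R : realType} (f : R -> \bar R) (a b : R) :
    b != 0 -> measurable_fun [set: R] f -> (forall x, 0 <= f x)%E ->
  (\int[lebesgue_measure]_x f x =
   `|b|%:E * \int[lebesgue_measure]_x f (a + b * x)%R)%E.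
Proof.
move=> b0 mf f0.
pose phi : measurableTypeR R -> measurableTypeR R := fun x => a + b * x.
have mphi : measurable_fun setT phi by exact: measurable_affine.
rewrite -(@ge0_integral_pushforward _ _ _ _ _ phi mphi lebesgue_measure setT)//.
rewrite -(@ge0_integral_mscale _ _ _ _ _ measurableT (NngNum (normr_ge0 b)))//.
by apply: eq_measure_integral => A mA _; exact: lebesgue_measure_affine.
Qed.

(** Strict monotonicity turns [F x <= F y] into [x <= y], so the infimum is taken over a closed
    half-line starting at [x]. *)
Lemma quantileK {R : realType} (F : R -> R) (x : R) :
  {homo F : x y / x < y} -> quantile F (F x) = x.
Proof.
move=> /le_mono F_mono; rewrite /quantile (_ : mkset _ = `[x, +oo[%classic).
  by rewrite inf_itv.
by apply/seteqP; split => y /=; rewrite in_itv/= andbT F_mono.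
Qed.

Lemma quantile_loc_scale {R : realType} (F : R -> R) (a b x : R) :
  {homo F : x y / x < y} -> 0 < b ->
  quantile (loc_scale F a b) (F x) = a + b * x.
Proof.
move=> F_incr b0.
have -> : F x = loc_scale F a b (a + b * x).
  by rewrite /loc_scale; congr F; field; rewrite gt_eqF.
apply: quantileK => y z yz; apply: F_incr.
by rewrite ltr_pM2r ?invr_gt0// ltrD2r.
Qed.

Lemma lebesgue_stieltjes_measure_oc {R : realType} (F : cumulative R R) (a b : R) :
  a <= b -> lebesgue_stieltjes_measure F `]a, b] = (F b - F a)%:E.
Proof.
move=> ab; rewrite /lebesgue_stieltjes_measure /measure_extension/=.
by rewrite measurable_mu_extE/= ?wlength_itv_bnd//; exact: is_ocitv.
Qed.

Section quantile_pushforward.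
Context {R : realType} (G : cumulativeBounded (0 : R) (1 : R)).
Hypothesis G_incr : {homo (G : R -> R) : x y / x < y}.
Hypothesis G_cont : continuous (G : R -> R).

(** The limits at infinity give only weak bounds; applying them at [x - 1] and [x + 1] makes room
    for strict increase. *)
Lemma cdf_bounds x : 0 < G x < 1.
Proof.
apply/andP; split.
- apply: le_lt_trans (_ : G (x - 1) < G x); last by apply: G_incr; rewrite gtrBl.
  rewrite leNgt; apply/negP => Gx0.
  have [t [Gt tx]] := filter_ex (filterI (cvgr_gt _ (cumulativeNy G) _ Gx0)
    (nbhs_ninfty_le (num_real (x - 1)))).
  by move: Gt; rewrite ltNge cumulative_is_nondecreasing.
- apply: lt_le_trans (_ : G (x + 1) <= 1); first by apply: G_incr; rewrite ltrDl.
  rewrite leNgt; apply/negP => Gx1.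
  have [t [Gt xt]] := filter_ex (filterI (cvgr_lt _ (cumulativey G) _ Gx1)
    (nbhs_pinfty_ge (num_real (x + 1)))).
  by move: Gt; rewrite ltNge cumulative_is_nondecreasing.
Qed.

(** Intermediate values between two tail points. Writing [u] as [G x] is what lets [quantileK]
    evaluate quantiles on the whole of (0, 1). *)
Lemma cdf_surj u : 0 < u < 1 -> exists x, G x = u.
Proof.
move=> /andP[u0 u1].
have [s [Gsu s0]] := filter_ex (filterI (cvgr_le _ (cumulativeNy G) _ u0)
  (nbhs_ninfty_le (num_real 0))).
have [t [Gut t0]] := filter_ex (filterI (cvgr_ge _ (cumulativey G) _ u1)
  (nbhs_pinfty_ge (num_real 0))).
have st : s <= t := le_trans s0 t0.
have [|x _ Gx] := @IVT _ (G : R -> R) _ _ u st (continuous_subspaceT G_cont).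
  by rewrite ge_min le_max Gsu Gut orbT.
by exists x.
Qed.

Lemma measurable_quantile : measurable_fun `](0 : R), 1[ (quantile G).
Proof.
move=> mD; apply: (measurability _ (RGenCInfty.measurableE R)) => //.
move=> _ [_ [r ->] <-].
(* On (0, 1), [r <= quantile G u] is equivalent to [G r <= u]. *)
rewrite (_ : _ `&` _ = `[G r, 1[%classic)//.
have G_mono := le_mono G_incr.
apply/seteqP; split => u /=; rewrite !in_itv/= ?andbT.
  move=> [u01]; have [x ux] := cdf_surj _ u01; move: u01; rewrite -ux.
  by rewrite quantileK// G_mono => /andP[_ ->] ->.
move=> /andP[ru u1].
have u01 : 0 < u < 1.
  by have /andP[Gr0 _] := cdf_bounds r; rewrite u1 (lt_le_trans Gr0 ru).
have [x ux] := cdf_surj _ u01; split => //; move: ru; rewrite -ux.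
by rewrite quantileK// G_mono.
Qed.

(** The uniform law pushed forward by the quantile function and the Stieltjes measure both give []c,
    d]] the mass [G d - G c], hence coincide. *)
Lemma integral_quantile (f : R -> \bar R) :
    measurable_fun [set: R] f -> (forall x, 0 <= f x)%E ->
  (\int[lebesgue_measure]_(u in `]0%R, 1%R[) f (quantile G u) =
   \int[lebesgue_stieltjes_measure G]_x f x)%E.
Proof.
move=> mf f0.
(* [quantile G] is only controlled on (0, 1), and pushforward measures require
   a map that is measurable everywhere. *)
pose q : measurableTypeR R -> measurableTypeR R := quantile G \_ `](0 : R), 1[.
have mq : measurable_fun setT q.
  apply: (measurable_restrictT (quantile G) _).1 => //.
  exact: measurable_quantile.
pose lambda01 := mrestr (@lebesgue_measure R) (measurable_itv `](0 : R), 1[).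
transitivity (\int[pushforward lambda01 q]_x f x)%E.
  rewrite ge0_integral_pushforward// ge0_integral_mrestr//.
  - by apply: eq_integral => u u01; rewrite /q /= patchE u01.
  - exact: (measurableT_comp mf mq).
  - by move=> u; exact: f0.
apply: eq_measure_integral => A mA _; apply/esym.
apply: (@lebesgue_stieltjes_measure_unique _ _ (pushforward lambda01 q)) => //.
move=> _ [[c d]] _ <-.
rewrite /= /pushforward /lambda01 /mrestr/=.
have [cd|dc] := leP c d; last first.
  by rewrite set_itv_ge -?leNgt ?bnd_simp ?ltW// preimage_set0 set0I !measure0.
rewrite lebesgue_stieltjes_measure_oc//.
rewrite (_ : _ `&` _ = `]G c, G d]%classic).
  rewrite lebesgue_measure_itv/= lte_fin.
  (* In the degenerate case [G d <= G c], monotonicity forces equality and both sides are 0. *)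
  have [//|] := ltP (G c) (G d).
  have := cumulative_is_nondecreasing G _ _ cd => cd' dc'.
  by rewrite (@le_anti _ _ (G c) (G d)) ?subrr ?cd'.
have G_mono := le_mono G_incr; have G_lt := leW_mono G_mono.
apply/seteqP; split => u /=.
  move=> [+ u01]; rewrite /q /= patchE mem_set//.
  have [x ux] := cdf_surj _ u01; rewrite -ux quantileK//.
  by rewrite !in_itv/= G_mono G_lt.
rewrite in_itv/= => /andP[cu ud].
have u01 : 0 < u < 1.
  have /andP[Gc0 _] := cdf_bounds c; have /andP[_ Gd1] := cdf_bounds d.
  by rewrite (lt_trans Gc0 cu) (le_lt_trans ud Gd1).
split; last by rewrite in_itv.
have [x ux] := cdf_surj _ u01; rewrite /q /= patchE mem_set/= in_itv//=.
by rewrite -ux quantileK// -G_lt -G_mono ux cu.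
Qed.

End quantile_pushforward.

(** The density [g] and the Radon-Nikodym derivative have equal integrals over every measurable set,
    so they agree almost everywhere and [g] may replace the derivative in the change of
    variables. *)
Lemma integral_density {R : realType} (G : cumulativeBounded (0 : R) (1 : R))
    (g : R -> R) (f : R -> \bar R) :
    is_density G g -> measurable_fun [set: R] f -> (forall x, 0 <= f x)%E ->
  (\int[lebesgue_stieltjes_measure G]_x f x =
   \int[lebesgue_measure]_x (f x * (g x)%:E))%E.
Proof.
move=> [mg g0 gE] mf f0.
have GE : lebesgue_stieltjes_measure G `<< (@lebesgue_measure R).
  apply/null_content_dominatesP => A mA A0.
  rewrite gE// null_set_integral//.
  exact/measurable_EFinP/measurable_funTS.
rewrite -(Radon_Nikodym_SigmaFinite.change_of_variables GE)//.
apply: ae_eq_integral => //.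
- apply: emeasurable_funM => //.
  exact: measurable_int (Radon_Nikodym_SigmaFinite.f_integrable GE).
- by apply: emeasurable_funM => //; exact/measurable_EFinP.
- apply: ae_eqe_mul2l; apply: integral_ae_eq => //.
  + exact: Radon_Nikodym_SigmaFinite.f_integrable.
  + exact/measurable_EFinP.
  + move=> A _ mA; rewrite -Radon_Nikodym_SigmaFinite.f_integral//; exact: gE.
Qed.

Lemma g_transformE {R : realType} (G : cumulativeBounded (0 : R) (1 : R))
    (g h : R -> R) (a b : R) :
    {homo (G : R -> R) : x y / x < y} -> continuous (G : R -> R) ->
    is_density G g -> measurable_fun [set: R] h -> (forall x, 0 <= h x) ->
    0 < b -> b != 1 ->
  g_transform g h a (b - 1) = (`|b - 1|%:E * ot_cost h (loc_scale G a b) G)%E.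
Proof.
move=> G_incr G_cont g_density mh h0 b0 b1.
have [mg g0 _] := g_density.
have b10 : b - 1 != 0 by rewrite subr_eq0.
have mh' : measurable_fun [set: R] (fun x => (h (a + (b - 1) * x))%:E).
  apply/measurable_EFinP; apply: measurableT_comp => //.
  exact: measurable_affine.
transitivity (`|b - 1|%:E *
    \int[lebesgue_measure]_x ((h (a + (b - 1) * x))%:E * (g x)%:E))%E.
  rewrite /g_transform (@ge0_integral_affine _ _ a (b - 1))//.
  - congr (_ * _)%E; apply: eq_integral => x _.
    by rewrite -EFinM mulrC; congr (_ * g _)%:E; field.
  - apply/measurable_EFinP/measurable_funM => //.
    apply: measurableT_comp => //; apply: measurable_funM => //.
    exact: measurable_funB.
  - by move=> x; rewrite lee_fin mulr_ge0.
rewrite -(integral_density _ _ (fun x => (h (a + (b - 1) * x))%:E) g_density)//;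
  last by move=> x; rewrite lee_fin.
rewrite -integral_quantile//; last by move=> x; rewrite lee_fin.
congr (_ * _)%E; apply: eq_integral => u; rewrite inE/= in_itv/= => u01.
(* At [u = G x] the quantile difference is [(a + b * x) - x = a + (b - 1) * x]. *)
have [x ux] := cdf_surj _ G_cont _ u01.
rewrite -ux quantile_loc_scale// quantileK//; congr (h _)%:E; ring.
Qed.

Theorem theorem4p2 (R : realType) (H' : set (R -> R))
    (G : cumulativeBounded (0 : R) (1 : R)) (g : R -> R)
    (H'_sub : H' `<=` @H1 R)
    (G_incr : {homo (G : R -> R) : x y / x < y})
    (G_diff : forall x : R, derivable (G : R -> R) x 1)
    (g_density : is_density G g)
    (finite_costs : forall h : R -> R, (H' `&` L1 G) h ->
       forall a b : R, 0 < b -> b != 1 ->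
         (ot_cost h (loc_scale G a b) G < +oo)%E) :
  identifiable G (H' `&` L1 G) <-> g_transform_injective g (H' `&` L1 G).
Proof.
have G_cont : continuous (G : R -> R).
  by move=> x; exact/differentiable_continuous/derivable1_diffP.
have transform h a b : (H' `&` L1 G) h -> 0 < b -> b != 1 ->
    g_transform g h a (b - 1) = (`|b - 1|%:E * ot_cost h (loc_scale G a b) G)%E.
  (* Measurability of [h] comes from its integrability, nonnegativity from [H1]. *)
  move=> [/H'_sub[_ h0 _] /integrableP[/measurable_EFinP mh _]].
  exact: g_transformE.
split=> [ident h1 h2 K1 K2 eq_g|inj h1 h2 K1 K2 eq_ot].
- apply: ident => // a b b0 b1; have b10 : b - 1 != 0 by rewrite subr_eq0.
  have := eq_g a (b - 1); rewrite !transform// b10 ltrBrDr addNr => /(_ b0 isT).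
  (* The factor [|b - 1|] is finite and nonzero, so it cancels in the extended reals. *)
  move=> /(congr1 (mule (`|b - 1|^-1)%:E)).
  by rewrite !muleA -EFinM mulVf ?normr_eq0// !mul1e.
- apply: inj => // a beta beta1 beta0.
  rewrite -[beta](addrK 1) !transform ?eq_ot//; lra.
Qed.
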